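(* Consider the system $$\begin{aligned} \dot a_k&=(\lambda_m-\lambda_n)\Gamma a_ma_n,\\ \dot a_m&=(\lambda_n-\lambda_k)\Gamma a_na_k,\\ \dot a_n&=(\lambda_k-\lambda_m)\Gamma a_ka_m+(\lambda_{\tilde k}-\lambda_{\tilde m})\tilde\Gamma a_{\tilde k}a_{\tilde m},\\ \dot a_{\tilde m}&=(\lambda_n-\lambda_{\tilde k})\tilde\Gamma a_na_{\tilde k},\\ \dot a_{\tilde k}&=(\lambda_{\tilde m}-\lambda_n)\tilde\Gamma a_{\tilde m}a_n, \end{aligned}$$ under the conditions $\lambda_m<\lambda_k<\lambda_n$ and $\lambda_{\tilde m}<\lambda_n<\lambda_{\tilde k}$. The hyperbolic critical points $(\pm a_k(0),0,0,0,\pm a_{\tilde k}(0))$ possess 1-dimensional homoclinic cycles on the cones $$a_n^2+(1-\tilde\alpha)a_{\tilde m}^2=-\alpha a_m^2,$$ with $\alpha<0$, $\tilde\alpha<0$.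
   Context: The unknowns are real-valued and ordered as $(a_k,a_m,a_n,a_{\tilde m},a_{\tilde k})$. The $\lambda$'s are real (curl eigenvalues) and $\Gamma,\tilde\Gamma$ are real parameters (nonzero interaction coefficients). $\alpha=(\lambda_m-\lambda_k)/(\lambda_n-\lambda_k)$ and $\tilde\alpha=(\lambda_{\tilde m}-\lambda_n)/(\lambda_{\tilde k}-\lambda_n)$. The critical points considered have $a_k(0)\neq0$, $a_{\tilde k}(0)\neq0$ and $|a_{\tilde k}(0)|$ small enough with respect to $|a_k(0)|$, in which case they are hyperbolic for the dynamics restricted to the level sets of the conserved quantities $a_k^2+(1-\alpha)a_m^2$, $a_n^2+\alpha a_m^2+(1-\tilde\alpha)a_{\tilde m}^2$, $a_{\tilde k}^2+\tilde\alpha a_{\tilde m}^2$. The homoclinic cycles are genuine homoclinic orbits (each connecting a critical point to itself), not sums of heteroclinic connections. *)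

(* Defs.v *)
From HB Require Import structures.
From mathcomp Require Import all_boot all_order all_algebra.
From mathcomp Require Import complex.
From mathcomp Require Import all_classical all_reals all_analysis.

Set Implicit Arguments.
Unset Strict Implicit.
Unset Printing Implicit Defensive.

Import Order.TTheory GRing.Theory Num.Theory.
Import numFieldNormedType.Exports.

Local Open Scope classical_set_scope.
Local Open Scope ring_scope.

Section Dynamics.
Variables (R : realType) (d : nat).
Implicit Types (F : 'rV[R]_d -> 'rV[R]_d) (S C : set 'rV[R]_d).
Implicit Types (p v : 'rV[R]_d) (a : R -> 'rV[R]_d).

Definition solution F a : Prop :=
  forall t : R, is_derive t 1 a (F (a t)).

(* Bouligand tangent cone: limits of the difference quotients of sequences of
   S converging to p. It is the tangent space where S is a submanifold, but it
   also makes sense at the vertex of a cone. *)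
Definition tangent_cone S p : set 'rV[R]_d :=
  [set v | exists (h : nat -> R) (u : nat -> 'rV[R]_d),
     [/\ forall i, 0 < h i,
         h i @[i --> \oo] --> (0 : R),
         u i @[i --> \oo] --> v &
         forall i, S (p + h i *: u i)]].

(* The real points of the sum of the generalized eigenspaces of the
   linearization of F at p over the purely imaginary eigenvalues (0 included).
   A frequency w for which iw is not an eigenvalue contributes 0 to the sum. *)
Definition center_subspace F p : set 'rV[R]_d :=
  [set v | exists s : seq R,
     (map_mx (real_complex R) v <=
      \sum_(w <- s)
        geigenspace (map_mx (real_complex R) (jacobian F p)) (Complex 0 w))%MS].

(* Hyperbolicity of the critical point p for the dynamics restricted to an
   invariant set S: the linearization has no neutral direction tangent to S.
   Where S is a submanifold, this says that the linearization of the restricted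
   flow has no eigenvalue on the imaginary axis. *)
Definition hyperbolic_on S F p : Prop :=
  [/\ F p = 0, S p &
      forall v, tangent_cone S p v -> center_subspace F p v -> v = 0].

Definition homoclinic_orbit F p a : Prop :=
  [/\ solution F a,
      forall t, a t <> p,
      a t @[t --> -oo] --> p &
      a t @[t --> +oo] --> p].

(* A homoclinic orbit closed up by its critical point; it is one-dimensional
   in that the orbit is an injectively immersed line. *)
Definition homoclinic_cycle1 F p C : Prop :=
  exists a : R -> 'rV[R]_d,
    [/\ homoclinic_orbit F p a,
        injective a,
        forall t, 'D_1 a t <> 0 &
        C = [set p] `|` range a].

End Dynamics.

(* A suffix t in a name stands for a tilde. *)

Section FiveModes.
Variable R : realType.

Definition state (ak am an amt akt : R) : 'rV[R]_5 :=
  \row_(i < 5) [:: ak; am; an; amt; akt]`_i.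

Definition a_k (x : 'rV[R]_5) : R := x ord0 (@Ordinal 5 0 isT).
Definition a_m (x : 'rV[R]_5) : R := x ord0 (@Ordinal 5 1 isT).
Definition a_n (x : 'rV[R]_5) : R := x ord0 (@Ordinal 5 2 isT).
Definition a_mt (x : 'rV[R]_5) : R := x ord0 (@Ordinal 5 3 isT).
Definition a_kt (x : 'rV[R]_5) : R := x ord0 (@Ordinal 5 4 isT).

Definition alpha (lk lm ln : R) : R := (lm - lk) / (ln - lk).
Definition alphat (ln lmt lkt : R) : R := (lmt - ln) / (lkt - ln).

Definition five_mode_field (lk lm ln lmt lkt G Gt : R) (x : 'rV[R]_5) :
    'rV[R]_5 :=
  state
    ((lm - ln) * G * a_m x * a_n x)
    ((ln - lk) * G * a_n x * a_k x)
    ((lk - lm) * G * a_k x * a_m x + (lkt - lmt) * Gt * a_kt x * a_mt x)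
    ((ln - lkt) * Gt * a_n x * a_kt x)
    ((lmt - ln) * Gt * a_mt x * a_n x).

Definition conserved1 (al : R) (x : 'rV[R]_5) : R :=
  a_k x ^+ 2 + (1 - al) * a_m x ^+ 2.
Definition conserved2 (al alt : R) (x : 'rV[R]_5) : R :=
  a_n x ^+ 2 + al * a_m x ^+ 2 + (1 - alt) * a_mt x ^+ 2.
Definition conserved3 (alt : R) (x : 'rV[R]_5) : R :=
  a_kt x ^+ 2 + alt * a_mt x ^+ 2.

Definition level_set (al alt : R) (p : 'rV[R]_5) : set 'rV[R]_5 :=
  [set x | [/\ conserved1 al x = conserved1 al p,
               conserved2 al alt x = conserved2 al alt p &
               conserved3 alt x = conserved3 alt p]].

Definition cone (al alt : R) : set 'rV[R]_5 :=
  [set x | a_n x ^+ 2 + (1 - alt) * a_mt x ^+ 2 = - al * a_m x ^+ 2].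

End FiveModes.

(* Main.v *)
Require Import Defs.
From mathcomp Require Import all_boot all_order all_algebra.
From mathcomp Require Import complex.
From mathcomp Require Import all_classical all_reals all_analysis.
From mathcomp Require Import ring lra.

Import Order.TTheory GRing.Theory Num.Theory.
Import numFieldNormedType.Exports.

Local Open Scope classical_set_scope.
Local Open Scope ring_scope.

(* With q' = a_n the equations for (a_k, a_m) and (a_kt, a_mt) become a rotation
   and a hyperbolic rotation in q, so that on the cone the whole system reduces
   to q'^2 = V(q), where V(q) = a^2 sin^2(w q) - b^2 sinh^2(m q). The point p is
   hyperbolic exactly when a w > b m, that is when V is positive on some ]0, x0[
   vanishing simply at x0; then q leaves 0 at t = -oo, bounces at x0 and comes
   back to 0 at t = +oo. Substituting q = x0 / (1 + Y^2) makes the bounce a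
   regular point: Y solves a scalar equation Y' = K(Y) with K > 0 continuous. *)

Set Implicit Arguments.
Unset Strict Implicit.

(** The two criteria of the overview meet in one number. The linearization J at p satisfies J^3 =
    [growth] J, so its nonzero eigenvalues can only be the square roots of [growth]; and [growth]
    equals (a w)^2 - (b m)^2. Hence hyperbolicity by itself yields the orbit, and the smallness of
    a_kt(0) serves only to produce hyperbolicity. Two obstacles shape the proof. At the bounce, q' =
    - sqrt(V(q)) and q' = sqrt(V(q)) must be glued at a point where the square root is not Lipschitz
    and the constant x0 is a competing solution; in the variable Y the factor Y^2 cancels the simple
    zero of V, and Y can be found by quadrature, with no uniqueness theorem. At p, the gradient of
    the second conserved quantity vanishes, so the level set is singular there, and hyperbolicity is
    tested on a tangent cone which need not be a linear space. *)

Section Calculus.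
Variable R : realType.
Implicit Types (f df F : R -> R) (x : R).

Lemma is_derive_continuous f (x l : R) : is_derive x 1 f l -> {for x, continuous f}.
Proof.
move=> df; apply/differentiable_continuous/derivable1_diffP.
by case: df.
Qed.

Lemma is_derive_within_continuous f df (a b : R) :
  (forall x, x \in `[a, b] -> is_derive x 1 f (df x)) ->
  {within `[a, b], continuous f}.
Proof.
move=> fdf; apply: derivable_within_continuous => x xab.
by case: (fdf x xab).
Qed.

Lemma is_derive_gt0_lt f df (a b : R) : a < b ->
  (forall x, x \in `[a, b] -> is_derive x 1 f (df x)) ->
  (forall x, a < x < b -> 0 < df x) -> f a < f b.
Proof.
move=> ab fdf df0.
have sub x : x \in `]a, b[ -> x \in `[a, b].
  by apply: subset_itvW.
have [c cab E] := MVT ab (fun x h => fdf x (sub x h))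
  (is_derive_within_continuous fdf).
by rewrite -subr_gt0 E mulr_gt0 ?subr_gt0// df0// (itvP cab).
Qed.

Lemma is_derive_ge0_le f df (a b : R) : a <= b ->
  (forall x, is_derive x 1 f (df x)) ->
  (forall x, 0 <= df x) -> f a <= f b.
Proof.
move=> ab fdf df0.
have [c _ E] := MVT_segment ab (fun x _ => fdf x)
  (is_derive_within_continuous (fun x _ => fdf x)).
by rewrite -subr_ge0 E mulr_ge0 ?subr_ge0.
Qed.

(** The fundamental theorem of calculus is applied to the right of a base point; to cover the whole
    line the base point moves with x. Subtracting the integral up to 0 makes the value independent
    of the base. *)
Lemma continuous_antiderivative f : continuous f ->
  exists F, forall x, is_derive x 1 F (f x).
Proof.
move=> cf.
pose mu := @lebesgue_measure R.
have itf a b : mu.-integrable `[a, b] (EFin \o f).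
  apply: continuous_compact_integrable; first exact: segment_compact.
  exact: continuous_subspaceT.
pose F a x := (\int[mu]_(t in `[a, x]) f t - \int[mu]_(t in `[a, 0]) f t)%R.
have dF a x : a < x -> is_derive x 1 (F a) (f x).
  move=> ax.
  have [d1 d2] := @continuous_FTC1_closed R f a x (x + 1)
    ltac:(by rewrite ltrDl) (itf _ _) ax (cf x).
  have -> : F a = (fun y => \int[mu]_(t in `[a, y]) f t)%R
      - cst (\int[mu]_(t in `[a, 0]) f t)%R by [].
  rewrite -[f x]subr0; apply: is_deriveB.
  by rewrite -d2 derive1E; exact/derivableP.
have FE a b x : a <= b -> b <= x -> b <= 0 -> F a x = F b x.
  move=> ab bx b0.
  have E y : b <= y -> (\int[mu]_(t in `[a, y]) f t =
     \int[mu]_(t in `[a, b]) f t + \int[mu]_(t in `[b, y]) f t)%R.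
    move=> b_y; rewrite -(@Rintegral_itv_obnd_cbnd _ b (BRight y)); last first.
      by apply: integrableS (itf b y) => //; exact: subset_itv_oc_cc.
    by rewrite -(@Rintegral_itvB R f (BLeft a) (BRight y) b) ?bnd_simp// addrC subrK.
  by rewrite /F (E x bx) (E 0 b0) opprD addrACA subrr add0r.
exists (fun x => F (- (`|x| + 1)) x) => x.
(* For y near x the base [- (|y| + 1)] stays to the right of [- (|x| + 2)], so a single fixed base
   serves on a neighbourhood of x. *)
apply: near_eq_is_derive (dF (- (`|x| + 2)) x _); last first.
  have := ler_norm (- x); rewrite normrN; lra.
near=> y.
have yx : `|y| < `|x| + 1.
  near: y; apply: (cvgr_lt `|x|); last by rewrite ltrDl.
  exact: norm_continuous.
have := ler_norm (- y); have := normr_ge0 y; rewrite normrN => h1 h2.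
by apply: FE; lra.
Unshelve. all: by end_near. Qed.

End Calculus.

(** * Global solutions of a scalar autonomous equation, by quadrature *)

Section ScalarFlow.
Variable R : realType.
Implicit Types (K : R -> R) (t x y : R).

Lemma is_derive_1Dsqr x : is_derive x 1 (fun y => 1 + y ^+ 2) (2 * x).
Proof.
have := is_deriveD (is_derive_cst (1 : R) x 1) (is_deriveX 2 (is_derive_id x 1)).
by rewrite add0r expr1 -[X in is_derive _ _ _ X]/(2 * x * 1) mulr1.
Qed.

Lemma is_derive_ln1Dsqr x :
  is_derive x 1 (fun y => ln (1 + y ^+ 2)) (2 * x / (1 + x ^+ 2)).
Proof.
have p : 0 < 1 + x ^+ 2 by rewrite ltr_pwDl// sqr_ge0.
have := @is_derive1_comp _ (@ln R) _ x _ _ (is_derive1_ln p) (is_derive_1Dsqr x).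
by rewrite mulrC.
Qed.

(* The solution is the inverse of the travel time T(y) = int_0^y 1 / K; the
   bound on K forces C |T(y)| >= ln(1 + y^2), so no end is reached in finite
   time. *)
Lemma scalar_flow K (C : R) : continuous K -> (forall y, 0 < K y) -> 0 < C ->
  (forall y, 2 * `|y| * K y <= C * (1 + y ^+ 2)) ->
  exists Y : R -> R, [/\ forall t, is_derive t 1 Y (K (Y t)), Y 0 = 0,
    injective Y, Y t @[t --> +oo] --> +oo & Y t @[t --> -oo] --> -oo].
Proof.
move=> cK K0 C0 KC.
have cKV : continuous (fun y => (K y)^-1).
  by move=> y; apply: cvgV; [rewrite gt_eqF|exact: cK].
have [T0 dT0] := continuous_antiderivative cKV.
pose T y := T0 y - T0 0.
have dT y : is_derive y 1 T (K y)^-1.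
  rewrite -[(K y)^-1]subr0.
  by apply: (@is_deriveB _ _ _ T0 (cst (T0 0))).
have TE : T 0 = 0 by rewrite /T subrr.
have Tlt x y : x < y -> T x < T y.
  move=> xy; apply: (is_derive_gt0_lt xy (fun z _ => dT z)) => z _.
  by rewrite invr_gt0.
have TltE x y : (T x < T y) = (x < y).
  apply/idP/idP => [|/Tlt//]; case: (ltgtP x y) => // [/Tlt|->].
    by move=> /lt_trans h /h; rewrite ltxx.
  by rewrite ltxx.
have Tinj : injective T.
  by move=> x y E; case: (ltgtP x y) => // /Tlt; rewrite E ltxx.
have speed y : `|2 * y / (1 + y ^+ 2)| <= C * (K y)^-1.
  have p : 0 < 1 + y ^+ 2 by rewrite ltr_pwDl// sqr_ge0.
  rewrite !normrM normfV (gtr0_norm p) (ger0_norm (_ : 0 <= 2))//.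
  by rewrite ler_pdivrMr// mulrAC ler_pdivlMr.
have low y : 0 <= y -> ln (1 + y ^+ 2) <= C * T y.
  move=> y0; rewrite -subr_ge0.
  have d (z : R) : is_derive z 1 (fun u => C * T u - ln (1 + u ^+ 2))
      (C * (K z)^-1 - 2 * z / (1 + z ^+ 2)).
    by apply: is_deriveB; exact: is_derive_ln1Dsqr.
  have /= := is_derive_ge0_le y0 d.
  rewrite TE mulr0 expr0n addr0 ln1 subrr; apply=> z.
  by rewrite subr_ge0 (le_trans _ (speed z))// ler_norm.
have high y : y <= 0 -> C * T y <= - ln (1 + y ^+ 2).
  move=> y0; rewrite -subr_le0 opprK.
  have d (z : R) : is_derive z 1 (fun u => C * T u + ln (1 + u ^+ 2))
      (C * (K z)^-1 + 2 * z / (1 + z ^+ 2)).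
    by apply: is_deriveD; exact: is_derive_ln1Dsqr.
  have /= := is_derive_ge0_le y0 d.
  rewrite TE mulr0 expr0n addr0 ln1 addr0; apply=> z.
  by rewrite -[X in _ + X]opprK subr_ge0 (le_trans _ (speed z))// -normrN ler_norm.
have surj t : exists y, T y = t.
  (* Since 1 + y^2 >= y, this y gives ln(1 + y^2) >= C |t|, so T takes values on both sides of t on
     the segment from -y to y. *)
  pose y := expR (C * `|t|).
  have y0 : 0 <= y := expR_ge0 _.
  have lny : C * `|t| <= ln (1 + y ^+ 2).
    rewrite -[C * _]expRK ler_ln ?posrE ?expR_gt0//; last first.
      by rewrite ltr_pwDl// sqr_ge0.
    rewrite -/y; have := sqr_ge0 (y - 1); nra.
  have h1 : `|t| <= T y by rewrite -(ler_pM2l C0) (le_trans lny)// low.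
  have h2 : T (- y) <= - `|t|.
    rewrite -(ler_pM2l C0) (le_trans (high _ _)) ?oppr_le0//.
    by rewrite sqrrN mulrN lerN2.
  have yy : - y <= y by rewrite (le_trans _ y0)// oppr_le0.
  have [||c _ E] := @IVT R T (- y) y t yy.
  - exact: (is_derive_within_continuous (fun x _ => dT x)).
  - rewrite ge_min le_max; apply/andP; split; apply/orP; [left|right].
      by rewrite (le_trans h2)// lerNl -normrN ler_norm.
    by rewrite (le_trans _ h1)// ler_norm.
  - by exists c.
have [Y YT] := choice surj.
have TY : cancel T Y by move=> y; apply: Tinj; rewrite YT.
have Ylt x y : (x < Y y) = (T x < y) by rewrite -[in RHS](YT y) TltE.
have Ygt x y : (Y y < x) = (y < T x) by rewrite -[in RHS](YT y) TltE.
exists Y; split.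
- move=> t; have := @is_derive_inverse _ T Y (K (Y t))^-1 (Y t).
  rewrite invrK YT; apply.
  + by near=> y; exact: TY.
  + by near=> x; exact: is_derive_continuous (dT x).
  + by rewrite invr_eq0 gt_eqF.
- by rewrite -TE TY.
- exact: can_inj YT.
- apply/cvgryPgt => A; near=> t; rewrite Ylt; near: t.
  by apply: nbhs_pinfty_gt; exact: num_real.
- apply/cvgrNyPlt => A; near=> t; rewrite Ygt; near: t.
  by apply: nbhs_ninfty_lt; exact: num_real.
Unshelve. all: by end_near. Qed.

End ScalarFlow.

(** * Motion in a potential well with a simple turning point *)

Section PotentialWell.
Variable R : realType.
Implicit Types (V dV : R -> R) (t x y z : R).

(** Carathéodory's form of the derivative supplies the continuous extension at [x0]. This factors
    the simple zero out of V using differentiability only. *)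
Lemma is_derive_slope V (x0 l : R) :
  is_derive x0 1 V l -> V x0 = 0 -> continuous V ->
  continuous (fun z => if z == x0 then - l else V z / (x0 - z)).
Proof.
move=> /is_derive1_caratheodory[g [gE cg gl]] V0 cV z.
have [->|zx0] := eqVneq z x0.
  rewrite /continuous_at eqxx -gl.
  have -> : (fun z => if z == x0 then - g x0 else V z / (x0 - z)) = - g.
    apply/funext => u /=; case: eqVneq => [->//|ux0].
    have := gE u; rewrite V0 subr0 => ->.
    by rewrite -[x0 - u]opprB invrN mulrN mulfK// subr_eq0.
  exact: cvgN cg.
rewrite /continuous_at ifN//.
have cW : (fun u => V u / (x0 - u)) @ z --> V z / (x0 - z).
  apply: cvgM; first exact: cV.
  apply: cvgV; first by rewrite subr_eq0 eq_sym.
  by apply: cvgB; [exact: cvg_cst|exact: cvg_id].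
apply: cvg_trans cW; apply: near_eq_cvg; near=> u; rewrite ifN// -subr_eq0.
near: u; apply: (cvgr_neq0 (z - x0)); last by rewrite subr_eq0.
by apply: cvgB; [exact: cvg_id|exact: cvg_cst].
Unshelve. all: by end_near. Qed.

Lemma is_derive_scaled_witch (c x : R) :
  is_derive x 1 (fun y => c / (1 + y ^+ 2)) (- 2 * c * x / (1 + x ^+ 2) ^+ 2).
Proof.
have p : 1 + x ^+ 2 != 0 by rewrite gt_eqF// ltr_pwDl// sqr_ge0.
have d := is_deriveZ c (@is_deriveV _ (fun y : R => 1 + y ^+ 2) _ _ _ p
  (is_derive_1Dsqr x)).
by apply: is_derive_eq d _; rewrite -![_ *: _]/(_ * _); field.
Qed.

(** The quadratic bound on V makes 0 unreachable in finite time. The pair (q, v) is injective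
    although q alone is not: q is even in Y, and v tells the two signs apart. *)
Lemma potential_homoclinic V dV (x0 C : R) : 0 < x0 -> 0 < C ->
  (forall x, is_derive x 1 V (dV x)) -> V x0 = 0 -> dV x0 < 0 ->
  (forall x, 0 < x < x0 -> 0 < V x) ->
  (forall x, 0 < x <= x0 -> V x <= C ^+ 2 * x ^+ 2) ->
  exists q v : R -> R,
  [/\ forall t, is_derive t 1 q (v t),
      forall t, is_derive t 1 v (dV (q t) / 2),
      forall t, v t ^+ 2 = V (q t),
      forall t, 0 < q t <= x0 &
      [/\ forall s t, q s = q t -> v s = v t -> s = t,
          q t @[t --> +oo] --> (0 : R) & q t @[t --> -oo] --> (0 : R)]].
Proof.
move=> x0_gt0 C0 dVE Vx0 dVx0 Vpos VC.
have cV : continuous V by move=> x; exact: is_derive_continuous (dVE x).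
pose W z := if z == x0 then - dV x0 else V z / (x0 - z).
have cW : continuous W := is_derive_slope (dVE x0) Vx0 cV.
have WE z : V z = W z * (x0 - z).
  rewrite /W; case: eqVneq => [->|zx0]; first by rewrite subrr mulr0.
  by rewrite divfK// subr_eq0 eq_sym.
have W0 z : 0 < z <= x0 -> 0 < W z.
  move=> /andP[z0]; rewrite /W le_eqVlt => /orP[/eqP->|zx0].
    by rewrite eqxx oppr_gt0.
  by rewrite lt_eqF// divr_gt0 ?subr_gt0// Vpos// z0.
have D0 y : 0 < 1 + y ^+ 2 by rewrite ltr_pwDl// sqr_ge0.
have D1 y : 1 <= 1 + y ^+ 2 by rewrite lerDl sqr_ge0.
pose u y := x0 / (1 + y ^+ 2).
have u0 y : 0 < u y <= x0.
  by rewrite divr_gt0//= ler_pdivrMr// ler_peMr// ltW.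
have cu : continuous u.
  by move=> y; exact: is_derive_continuous (is_derive_scaled_witch x0 y).
(* With q = u(Y), x0 - q = x0 Y^2 / (1 + Y^2) and q' = - 2 x0 Y Y' / (1 + Y^2)^2. In q'^2 = W(q) (x0
   - q) the factor Y^2 cancels, leaving Y'^2 = K(Y)^2. *)
pose K y := Num.sqrt (W (u y) * (1 + y ^+ 2) ^+ 3 / (4 * x0)).
have Ksq y : K y ^+ 2 = W (u y) * (1 + y ^+ 2) ^+ 3 / (4 * x0).
  by rewrite sqr_sqrtr// divr_ge0 ?mulr_ge0 ?exprn_ge0// ltW// W0.
have K0 y : 0 < K y.
  by rewrite sqrtr_gt0 divr_gt0 ?mulr_gt0 ?exprn_gt0// W0.
have cX n : continuous (fun y => (1 + y ^+ 2) ^+ n).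
  move=> y; exact: (continuous_comp (is_derive_continuous (is_derive_1Dsqr y))
    (@exprn_continuous R n _)).
have cK : continuous K.
  have cK2 : continuous (fun y => W (u y) * (1 + y ^+ 2) ^+ 3 / (4 * x0)).
    move=> y; apply: cvgM; last exact: cvg_cst.
    apply: cvgM; last exact: cX.
    exact: (continuous_comp (cu y) (cW (u y))).
  by move=> y; exact: (continuous_comp (cK2 y) (@sqrt_continuous R _)).
have KV y : 4 * y ^+ 2 * K y ^+ 2 * x0 ^+ 2 = V (u y) * (1 + y ^+ 2) ^+ 4.
  rewrite Ksq WE /u; field.
  by rewrite !gt_eqF.
have KC y : 2 * `|y| * K y <= C * (1 + y ^+ 2).
  have l0 : 0 <= 2 * `|y| * K y by rewrite !mulr_ge0// ltW.
  have r0 : 0 <= C * (1 + y ^+ 2) by rewrite mulr_ge0// ltW.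
  rewrite -ler_sqr ?nnegrE// -(ler_pM2r (exprn_gt0 2 x0_gt0)).
  rewrite !exprMn real_normK ?num_real//.
  rewrite (_ : 2 ^+ 2 = 4) ?KV; last by rewrite expr2; ring.
  apply: le_trans (_ : C ^+ 2 * u y ^+ 2 * (1 + y ^+ 2) ^+ 4 <= _).
    by rewrite ler_pM2r ?exprn_gt0// VC.
  rewrite le_eqVlt; apply/orP; left; apply/eqP; rewrite /u; field.
  by rewrite gt_eqF.
have [Y [dY Y0 Yinj Yp Yn]] := scalar_flow cK K0 C0 KC.
pose c y := - 2 * x0 * K y / (1 + y ^+ 2) ^+ 2.
pose q t := u (Y t).
pose v t := c (Y t) * Y t.
have c0 y : c y != 0.
  rewrite /c mulf_neq0 ?invr_neq0 ?expf_neq0 ?(lt0r_neq0 (D0 y))//.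
  rewrite mulf_neq0 ?(lt0r_neq0 (K0 y))//.
  by rewrite mulf_neq0 ?oppr_eq0 ?pnatr_eq0 ?lt0r_neq0.
have cc : continuous c.
  move=> y; apply: cvgM.
    by apply: cvgM; [exact: cvg_cst|exact: cK].
  by apply: cvgV; [rewrite gt_eqF ?exprn_gt0|exact: cX].
have cY : continuous Y by move=> t; exact: is_derive_continuous (dY t).
have cv : continuous v.
  by move=> t; apply: cvgM; [exact: (continuous_comp (cY t) (cc (Y t)))|exact: cY].
have dq t : is_derive t 1 q (v t).
  have := @is_derive1_comp _ u Y t _ _ (is_derive_scaled_witch x0 (Y t)) (dY t).
  by move=> d; apply: is_derive_eq d _; rewrite /v /c; ring.
have vsq t : v t ^+ 2 = V (q t).
  have h : (1 + Y t ^+ 2) ^+ 4 != 0 by rewrite gt_eqF ?exprn_gt0.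
  apply: (mulIf h); rewrite -KV /v /c.
  field.
  by rewrite gt_eqF.
exists q, v; split; [exact: dq| |exact: vsq| |].
- move=> t; have [Yt0|Yt0] := eqVneq (Y t) 0.
    have /is_derive1_caratheodory[h [hE ch ht]] := dY t.
    apply/is_derive1_caratheodory.
    exists (fun z => c (Y z) * h z); split.
    + by move=> z; rewrite /v Yt0 mulr0 subr0 -[RHS]mulrA -hE Yt0 subr0.
    + by apply: cvgM; [exact: (continuous_comp (cY t) (cc (Y t)))|exact: ch].
    + transitivity (- 2 * x0 * K (Y t) ^+ 2 / (1 + Y t ^+ 2) ^+ 2).
        by rewrite ht /c; ring.
      rewrite Ksq /q /u Yt0 (_ : 1 + 0 ^+ 2 = 1) ?expr0n ?addr0//.
      rewrite !expr1n !divr1 /W eqxx.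
      by field; rewrite gt_eqF.
  have vt0 : v t != 0.
    by rewrite /v mulf_neq0.
  have Vq0 : 0 < V (q t) by rewrite -vsq exprn_even_gt0.
  have dVq : is_derive t 1 (V \o q) (dV (q t) * v t).
    exact: is_derive1_comp (dVE (q t)) (dq t).
  have sgv : \forall s \near t, Num.sg (v t) = Num.sg (v s).
    move: (vt0); rewrite neq_lt => /orP[v0|v0].
      near=> s; rewrite !ltr0_sg//; near: s.
      by have /cvgr_lt/(_ _ v0) := cv t.
    near=> s; rewrite !gtr0_sg//; near: s.
    by have /cvgr_gt/(_ _ v0) := cv t.
  have := is_deriveZ (Num.sg (v t))
    (@is_derive1_comp _ (@Num.sqrt R) (V \o q) t _ _ (is_derive1_sqrt Vq0) dVq).
  move=> d; apply: (@near_eq_is_derive _ _ _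
    (fun s => Num.sg (v t) * Num.sqrt (V (q s)))).
    near=> s; rewrite -vsq sqrtr_sqr.
    have -> : Num.sg (v t) = Num.sg (v s) by near: s.
    by rewrite -numEsg.
  apply: is_derive_eq d _.
  rewrite /= -vsq sqrtr_sqr -[_ *: _]/(_ * _).
  rewrite {3}[v t]numEsg.
  have sv : Num.sg (v t) ^+ 2 = 1 by rewrite sqr_sg vt0.
  transitivity (Num.sg (v t) ^+ 2 * (dV (q t) / 2)); last by rewrite sv mul1r.
  by field; rewrite normr_eq0.
- by move=> t; exact: u0.
- split.
  + move=> s t qst vst; apply: Yinj.
    have sY : Y s ^+ 2 = Y t ^+ 2.
      move: qst => /(mulfI (lt0r_neq0 x0_gt0))/invr_inj.
      exact: addrI.
    (* [c] depends on Y through Y^2 only, and q determines Y^2; so v = c(Y) Y recovers Y. *)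
    have cst : c (Y s) = c (Y t) by rewrite /c /K (_ : u (Y s) = u (Y t))// sY.
    by apply: (mulfI (c0 (Y t))); rewrite -{1}cst.
  + apply/cvgrPdist_lt => e e0; near=> t.
    rewrite sub0r normrN gtr0_norm; last by case/andP: (u0 (Y t)).
    rewrite /q /u ltr_pdivrMr// -ltr_pdivrMl//.
    have Y1 : 1 + e^-1 * x0 < Y t.
      by near: t; move/cvgryPgt: Yp; apply.
    have : 0 < e^-1 * x0 by rewrite mulr_gt0 ?invr_gt0.
    nra.
  + apply/cvgrPdist_lt => e e0; near=> t.
    rewrite sub0r normrN gtr0_norm; last by case/andP: (u0 (Y t)).
    rewrite /q /u ltr_pdivrMr// -ltr_pdivrMl//.
    have Y1 : Y t < - (1 + e^-1 * x0).
      by near: t; move/cvgrNyPlt: Yn; apply.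
    have : 0 < e^-1 * x0 by rewrite mulr_gt0 ?invr_gt0.
    nra.
Unshelve. all: by end_near. Qed.

End PotentialWell.

(** * The concrete well a^2 sin^2(w x) - b^2 sinh^2(m x) *)

Section SinSinh.
Variable R : realType.
Implicit Types (x y : R).

Definition sinhR x := (expR x - expR (- x)) / 2.
Definition coshR x := (expR x + expR (- x)) / 2.

Lemma sinhR0 : sinhR 0 = 0.
Proof. by rewrite /sinhR oppr0 subrr mul0r. Qed.

Lemma coshR0 : coshR 0 = 1.
Proof. by rewrite /coshR oppr0 expR0 divff// pnatr_eq0. Qed.

Lemma coshR_gt0 x : 0 < coshR x.
Proof. by rewrite divr_gt0// addr_gt0// expR_gt0. Qed.

Lemma sinhR_gt0 x : 0 < x -> 0 < sinhR x.
Proof. by move=> x0; rewrite divr_gt0// subr_gt0 ltr_expR gtrN. Qed.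

Lemma is_derive_expRN x : is_derive x 1 (fun y => expR (- y)) (- expR (- x)).
Proof.
have := @is_derive1_comp _ (@expR R) -%R x _ _
  (is_derive_expR (- x)) (is_deriveNid x 1).
by rewrite mulrN1.
Qed.

Lemma is_derive_sinhR x : is_derive x 1 sinhR (coshR x).
Proof.
have := is_deriveZ 2^-1 (is_deriveB (is_derive_expR x) (is_derive_expRN x)).
rewrite opprK -[_ *: _]/(_ * _) mulrC => d.
suff -> : sinhR = 2^-1 *: (expR - (fun y => expR (- y))) by [].
by apply/funext => y; rewrite /sinhR mulrC.
Qed.

Lemma is_derive_coshR x : is_derive x 1 coshR (sinhR x).
Proof.
have := is_deriveZ 2^-1 (is_deriveD (is_derive_expR x) (is_derive_expRN x)).
rewrite -[_ *: _]/(_ * _) mulrC => d.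
suff -> : coshR = 2^-1 *: (expR + (fun y => expR (- y))) by [].
by apply/funext => y; rewrite /coshR mulrC.
Qed.

Lemma is_derive_compZ (f : R -> R) (df w x : R) :
  is_derive (w * x) 1 f df -> is_derive x 1 (fun y => f (w * y)) (df * w).
Proof.
move=> d; have dw : is_derive x 1 ( *%R w) w.
  apply: is_derive_eq (is_deriveZ w (is_derive_id x 1)) _.
  by rewrite -[_ *: _]/(_ * _) mulr1.
exact: (@is_derive1_comp _ f ( *%R w) x df w d dw).
Qed.

Lemma sinR_le x : 0 <= x -> sin x <= x.
Proof.
move=> x0; rewrite -subr_ge0.
have d (y : R) : is_derive y 1 (fun z => z - sin z) (1 - cos y).
  exact: (is_deriveB (is_derive_id y 1) (is_derive_sin y)).
have := is_derive_ge0_le x0 d; rewrite sin0 subr0; apply => y.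
by rewrite subr_ge0 cos_le1.
Qed.

(** The difference f of the two sides is strictly concave on [0, pi / w], starts at 0 with slope a w
    - b m > 0 and is negative at pi / w. It rises to a maximum x1, then decreases through a single
    zero, where its slope is negative. *)
Lemma sin_sinh_first_zero (a b w m : R) :
  0 < a -> 0 < b -> 0 < w -> 0 < m -> b * m < a * w ->
  exists x0 : R, [/\ 0 < x0, a * sin (w * x0) = b * sinhR (m * x0),
    a * w * cos (w * x0) < b * m * coshR (m * x0) &
    forall x, 0 < x < x0 -> b * sinhR (m * x) < a * sin (w * x)].
Proof.
move=> a0 b0 w0 m0 lt_bm_aw.
pose f x := a * sin (w * x) - b * sinhR (m * x).
pose f1 x := a * w * cos (w * x) - b * m * coshR (m * x).
pose f2 x := a * w ^+ 2 * sin (w * x) + b * m ^+ 2 * sinhR (m * x).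
have df (x : R) : is_derive x 1 f (f1 x).
  have d1 := is_deriveZ a (is_derive_compZ (is_derive_sin (w * x))).
  have d2 := is_deriveZ b (is_derive_compZ (is_derive_sinhR (m * x))).
  apply: is_derive_eq (is_deriveB d1 d2) _; rewrite -![_ *: _]/(_ * _) /f1; ring.
have df1 (x : R) : is_derive x 1 (fun x => - f1 x) (f2 x).
  have d1 := is_deriveZ (a * w) (is_derive_compZ (is_derive_cos (w * x))).
  have d2 := is_deriveZ (b * m) (is_derive_compZ (is_derive_coshR (m * x))).
  apply: is_derive_eq (is_deriveN (is_deriveB d1 d2)) _.
  rewrite -![_ *: _]/(_ * _) /f2; ring.
pose p := pi / w.
have p0 : 0 < p by rewrite divr_gt0// pi_gt0.
have wp : w * p = pi by rewrite mulrC divfK// gt_eqF.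
have f1_dec x y : 0 <= x -> x < y -> y <= p -> f1 y < f1 x.
  move=> x0 xy yp; rewrite -ltrN2.
  apply: (is_derive_gt0_lt xy (fun z _ => df1 z)) => z /andP[xz zy].
  have z0 : 0 < z by rewrite (le_lt_trans x0).
  apply: addr_gt0; last first.
    exact: mulr_gt0 (mulr_gt0 b0 (exprn_gt0 2 m0)) (sinhR_gt0 (mulr_gt0 m0 z0)).
  apply: mulr_gt0; first by rewrite mulr_gt0 ?exprn_gt0.
  rewrite sin_gt0_pi// mulr_gt0//= -wp ltr_pM2l//.
  exact: lt_le_trans yp.
have f1_0 : 0 < f1 0 by rewrite /f1 !mulr0 cos0 coshR0 !mulr1 subr_gt0.
have f1_p : f1 p < 0.
  rewrite /f1 wp cospi mulrN1 -opprD oppr_lt0.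
  exact: addr_gt0 (mulr_gt0 a0 w0) (mulr_gt0 (mulr_gt0 b0 m0) (coshR_gt0 _)).
have cf r s : {within `[r, s], continuous f}.
  exact: (is_derive_within_continuous (fun z _ => df z)).
have cf1 r s : {within `[r, s], continuous f1}.
  apply: continuous_subspaceT => v.
  have -> : f1 = - (fun x => - f1 x) by apply/funext => u; rewrite fctE opprK.
  exact: cvgN (is_derive_continuous (df1 v)).
have [|x1 + f1x1] := @IVT R f1 0 p 0 (ltW p0) (cf1 0 p).
  by rewrite ge_min le_max (ltW f1_0) (ltW f1_p) orbT.
rewrite in_itv/= => /andP[x1_ge0 x1_le_p].
have x10 : 0 < x1.
  rewrite lt_neqAle x1_ge0 andbT; apply: contraTneq f1_0 => E.
  by rewrite {2}E f1x1 ltxx.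
have x1_p : x1 < p.
  rewrite lt_neqAle x1_le_p andbT; apply: contraTneq f1_p => <-.
  by rewrite f1x1 ltxx.
have f_0 : f 0 = 0 by rewrite /f !mulr0 sin0 sinhR0 !mulr0 subr0.
have f_inc r : 0 < r <= x1 -> 0 < f r.
  move=> /andP[r0 rx1]; rewrite -f_0.
  apply: (is_derive_gt0_lt r0 (fun c _ => df c)) => c /andP[c0 cr].
  rewrite -f1x1; apply: f1_dec (ltW x1_p); first exact: ltW.
  exact: lt_le_trans rx1.
have f_dec r s : x1 <= r -> r < s -> s <= p -> f s < f r.
  move=> x1r rs sp; rewrite -ltrN2.
  apply: (is_derive_gt0_lt rs (fun c _ => is_deriveN (df c))) => c /andP[rc cs].
  rewrite oppr_gt0 -f1x1; apply: f1_dec; first exact: ltW.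
    exact: le_lt_trans rc.
  by rewrite (le_trans (ltW cs)).
have f_p : f p < 0.
  rewrite /f wp sinpi mulr0 sub0r oppr_lt0.
  exact: mulr_gt0 b0 (sinhR_gt0 (mulr_gt0 m0 p0)).
have fx1 : 0 < f x1 by rewrite f_inc// x10 lexx.
have [|x0 + fx0] := @IVT R f x1 p 0 (ltW x1_p) (cf x1 p).
  by rewrite ge_min le_max (ltW fx1) (ltW f_p) orbT.
rewrite in_itv/= => /andP[x0_ge_x1 x0_le_p].
have x1x0 : x1 < x0.
  rewrite lt_neqAle x0_ge_x1 andbT; apply: contraTneq fx1 => ->.
  by rewrite fx0 ltxx.
exists x0; split.
- exact: lt_trans x1x0.
- by apply/eqP; rewrite -subr_eq0; apply/eqP.
- by rewrite -subr_lt0 -/(f1 x0) -f1x1 f1_dec//// ltW.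
- move=> x /andP[x_gt0 xx0]; rewrite -subr_gt0 -/(f x).
  case: (leP x x1) => [xx1|x1x]; first by rewrite f_inc// x_gt0.
  by rewrite -fx0 f_dec//// ltW.
Qed.

(** V is (a sin - b sinh)(a sin + b sinh), and the second factor is positive on ]0, x0]. Thus V
    inherits the sign and the simple zero of the first factor. The bound drops the sinh term and
    uses sin y <= y. *)
Lemma sin_sinh_well (a b w m : R) :
  0 < a -> 0 < b -> 0 < w -> 0 < m -> b * m < a * w ->
  let V x := a ^+ 2 * sin (w * x) ^+ 2 - b ^+ 2 * sinhR (m * x) ^+ 2 in
  let dV x := 2 * (a ^+ 2 * w * sin (w * x) * cos (w * x)
                   - b ^+ 2 * m * sinhR (m * x) * coshR (m * x)) in
  exists x0 : R, [/\ 0 < x0, V x0 = 0, dV x0 < 0,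
    forall x, 0 < x < x0 -> 0 < V x &
    (forall x, is_derive x 1 V (dV x)) /\
    forall x, 0 < x <= x0 -> V x <= (a * w) ^+ 2 * x ^+ 2].
Proof.
move=> a0 b0 w0 m0 lt_bm_aw V dV.
have [x0 [x00 fx0 f1x0 fpos]] := sin_sinh_first_zero a0 b0 w0 m0 lt_bm_aw.
have VE x : V x = (a * sin (w * x) - b * sinhR (m * x)) *
                  (a * sin (w * x) + b * sinhR (m * x)) by rewrite /V; ring.
have sinh0 x : 0 < x -> 0 < b * sinhR (m * x).
  by move=> x_gt0; exact: mulr_gt0 b0 (sinhR_gt0 (mulr_gt0 m0 x_gt0)).
exists x0; split => //.
- by rewrite VE fx0 subrr mul0r.
- rewrite /dV.
  have -> : a ^+ 2 * w * sin (w * x0) * cos (w * x0) =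
    (a * sin (w * x0)) * (a * w * cos (w * x0)) by ring.
  rewrite fx0.
  have -> : b ^+ 2 * m * sinhR (m * x0) * coshR (m * x0) =
    (b * sinhR (m * x0)) * (b * m * coshR (m * x0)) by ring.
  by rewrite pmulr_rlt0// -mulrBr pmulr_rlt0 ?sinh0// subr_lt0.
- move=> x /andP[x_gt0 xx0].
  have fx : b * sinhR (m * x) < a * sin (w * x) by rewrite fpos// x_gt0.
  rewrite VE mulr_gt0 ?subr_gt0// addr_gt0 ?sinh0//.
  exact: lt_trans (sinh0 _ x_gt0) fx.
split.
  move=> x.
  have d1 := is_deriveZ (a ^+ 2)
    (is_deriveX 2 (is_derive_compZ (is_derive_sin (w * x)))).
  have d2 := is_deriveZ (b ^+ 2)
    (is_deriveX 2 (is_derive_compZ (is_derive_sinhR (m * x)))).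
  apply: is_derive_eq (is_deriveB d1 d2) _.
  by rewrite -![_ *: _]/(_ * _) /dV !expr1; ring.
move=> x /andP[x_gt0 xx0].
have fx : b * sinhR (m * x) <= a * sin (w * x).
  move: xx0; rewrite le_eqVlt => /orP[/eqP->|xx0]; first by rewrite fx0.
  by rewrite ltW// fpos// x_gt0.
have s0 : 0 <= a * sin (w * x) by rewrite (le_trans _ fx)// ltW// sinh0.
apply: le_trans (_ : (a * sin (w * x)) ^+ 2 <= _).
  by rewrite exprMn /V gerBl mulr_ge0 ?sqr_ge0.
have r0 : 0 <= a * w * x by rewrite !mulr_ge0// ltW.
rewrite -exprMn ler_sqr ?nnegrE//.
by rewrite -mulrA ler_pM2l// sinR_le// mulr_ge0 ?ltW.
Qed.

End SinSinh.

(** * Generalized eigenspaces of a matrix with J^3 = d J *)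

Section MatrixPolynomial.
Variables (K : numFieldType) (n : nat).
Implicit Types (J : 'M[K]_n.+1) (d a : K).

(** On vectors y with y J^2 = d y, such as y = u J, the map J - a is injective: y J = a y would give
    a^2 y = d y. A power of J - a that kills u J therefore forces u J = 0. *)
Lemma geigenspace_sub_ker J d a : J *m J *m J = d *: J -> a ^+ 2 != d ->
  (geigenspace J a <= kermx J)%MS.
Proof.
move=> J3 ad; apply/rV_subP => u; rewrite geigenspaceE => /sub_kermxP uJ.
apply/sub_kermxP.
have cancel_pow k (y : 'rV[K]_n.+1) :
    y *m J *m J = d *: y -> y *m (J - a%:M) ^+ k = 0 -> y = 0.
  elim: k y => [|k IH] y yJJ; first by rewrite expr0 mulmx1.
  rewrite exprS mulmxA => /IH y'0.
  have {y'0} : y *m (J - a%:M) = 0.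
    apply: y'0; rewrite mulmxBr mul_mx_scalar !mulmxBl yJJ -!scalemxAl yJJ.
    by rewrite scalerBr !scalerA mulrC.
  rewrite mulmxBr mul_mx_scalar => /subr0_eq yJ.
  move: yJJ; rewrite yJ -scalemxAl yJ scalerA -expr2 => /eqP.
  by rewrite -subr_eq0 -scalerBl scaler_eq0 subr_eq0 (negbTE ad) => /eqP.
apply: (cancel_pow n.+1).
  by rewrite -!mulmxA [J *m (J *m J)]mulmxA J3 -scalemxAr.
have cJ : GRing.comm J ((J - a%:M) ^+ n.+1).
  apply: commrX; apply: commrB; first exact: commr_refl.
  exact: scalar_mxC.
by rewrite -mulmxA [J *m _]cJ mulmxA uJ mul0mx.
Qed.

Lemma geigenspace_sum_full J d a (v : 'rV[K]_n.+1) :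
  J *m J *m J = d *: J -> a != 0 -> a ^+ 2 = d ->
  (v <= geigenspace J 0 + (geigenspace J a + geigenspace J (- a)))%MS.
Proof.
move=> J3 a0 ad.
have d0 : d != 0 by rewrite -ad expf_neq0.
(* J^2 / d is a projection: v - w lies in the kernel of J, and w J^2 = d w splits w into the
   eigenvectors (w + w J / a) / 2 and (w - w J / a) / 2. *)
pose w := d^-1 *: (v *m J *m J).
have vJ3 (u : 'rV_n.+1) : u *m J *m J *m J = d *: (u *m J).
  by rewrite -!mulmxA [J *m (J *m J)]mulmxA J3 -scalemxAr.
have wJJ : w *m J *m J = d *: w.
  by rewrite /w -!scalemxAl (vJ3 (v *m J)) !scalerA mulrC.
rewrite -[v](subrK w) addmx_sub_adds//.
  rewrite (submx_trans _ (eigenspace_sub_geigen _ _))//.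
  apply/eigenspaceP; rewrite scale0r mulmxBl /w -scalemxAl vJ3.
  by rewrite scalerA mulVf// scale1r subrr.
clearbody w.
have -> : w = 2^-1 *: (w + a^-1 *: (w *m J)) + 2^-1 *: (w - a^-1 *: (w *m J)).
  rewrite -scalerDr addrACA subrr addr0 -[X in _ *: (X + X)]scale1r -scalerDl scalerA.
  by rewrite mulVf ?scale1r// pnatr_eq0.
have eig e : e != 0 -> e ^+ 2 = d ->
    (2^-1 *: (w + e^-1 *: (w *m J)) <= geigenspace J e)%MS.
  move=> e0 ed; rewrite scalemx_sub// (submx_trans _ (eigenspace_sub_geigen _ _))//.
  apply/eigenspaceP; rewrite mulmxDl -scalemxAl wJJ scalerDr !scalerA -ed.
  by rewrite mulKf// mulfV// scale1r addrC.
rewrite addmx_sub_adds// ?eig// -scaleNr -invrN eig ?oppr_eq0//.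
by rewrite sqrrN.
Qed.

End MatrixPolynomial.

(** * Coordinates, limits and derivatives in the five-mode space *)

Section State.
Variable R : realType.
Implicit Types (x y v : 'rV[R]_5) (a b c d e : R).

Lemma stateE (x : 'rV[R]_5) : state (a_k x) (a_m x) (a_n x) (a_mt x) (a_kt x) = x.
Proof.
apply/rowP => -[[|[|[|[|[|//]]]]] i]; rewrite mxE /=;
  by congr (x _ _); apply/val_inj.
Qed.

Lemma state_inj x y : a_k x = a_k y -> a_m x = a_m y -> a_n x = a_n y ->
  a_mt x = a_mt y -> a_kt x = a_kt y -> x = y.
Proof. by move=> h1 h2 h3 h4 h5; rewrite -(stateE x) -(stateE y) h1 h2 h3 h4 h5. Qed.

Lemma a_kE a b c d e : a_k (state a b c d e) = a. Proof. by rewrite /a_k mxE. Qed.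
Lemma a_mE a b c d e : a_m (state a b c d e) = b. Proof. by rewrite /a_m mxE. Qed.
Lemma a_nE a b c d e : a_n (state a b c d e) = c. Proof. by rewrite /a_n mxE. Qed.
Lemma a_mtE a b c d e : a_mt (state a b c d e) = d. Proof. by rewrite /a_mt mxE. Qed.
Lemma a_ktE a b c d e : a_kt (state a b c d e) = e. Proof. by rewrite /a_kt mxE. Qed.

Definition stateEs := (a_kE, a_mE, a_nE, a_mtE, a_ktE).

Lemma coordsD x y : (a_k (x + y) = a_k x + a_k y) * (a_m (x + y) = a_m x + a_m y) *
  (a_n (x + y) = a_n x + a_n y) * (a_mt (x + y) = a_mt x + a_mt y) *
  (a_kt (x + y) = a_kt x + a_kt y).
Proof. by rewrite /a_k /a_m /a_n /a_mt /a_kt !mxE. Qed.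

Lemma coordsZ a x : (a_k (a *: x) = a * a_k x) * (a_m (a *: x) = a * a_m x) *
  (a_n (a *: x) = a * a_n x) * (a_mt (a *: x) = a * a_mt x) *
  (a_kt (a *: x) = a * a_kt x).
Proof. by rewrite /a_k /a_m /a_n /a_mt /a_kt !mxE. Qed.

Lemma stateZ r a b c d e :
  r *: state a b c d e = state (r * a) (r * b) (r * c) (r * d) (r * e).
Proof. by apply: state_inj; rewrite coordsZ !stateEs. Qed.

Lemma stateN a b c d e :
  - state a b c d e = state (- a) (- b) (- c) (- d) (- e).
Proof. by rewrite -scaleN1r stateZ !mulN1r. Qed.

Lemma stateD a b c d e a' b' c' d' e' :
  state a b c d e + state a' b' c' d' e' =
  state (a + a') (b + b') (c + c') (d + d') (e + e').
Proof. by apply: state_inj; rewrite coordsD !stateEs. Qed.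

Lemma state_sum a b c d e : state a b c d e =
  a *: state 1 0 0 0 0 + b *: state 0 1 0 0 0 + c *: state 0 0 1 0 0 +
  d *: state 0 0 0 1 0 + e *: state 0 0 0 0 1.
Proof. by apply: state_inj; rewrite !(coordsD, coordsZ, stateEs); ring. Qed.

Lemma cvg_state (T : Type) (F : set_system T) {FF : Filter F}
  (f1 f2 f3 f4 f5 : T -> R) a b c d e :
  f1 @ F --> a -> f2 @ F --> b -> f3 @ F --> c -> f4 @ F --> d -> f5 @ F --> e ->
  state (f1 t) (f2 t) (f3 t) (f4 t) (f5 t) @[t --> F] --> state a b c d e.
Proof.
move=> h1 h2 h3 h4 h5; rewrite state_sum.
under eq_fun do rewrite state_sum.
by do 4 (apply: cvgD; last by apply: cvgZr_tmp); apply: cvgZr_tmp.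
Qed.

Lemma cvg_coords (T : Type) (F : set_system T) {FF : Filter F} (u : T -> 'rV[R]_5) v :
  u @ F --> v ->
  [/\ a_k (u t) @[t --> F] --> a_k v, a_m (u t) @[t --> F] --> a_m v,
      a_n (u t) @[t --> F] --> a_n v, a_mt (u t) @[t --> F] --> a_mt v &
      a_kt (u t) @[t --> F] --> a_kt v].
Proof.
by move=> uv; split; apply: (cvg_comp _ _ uv); exact: coord_continuous.
Qed.

Lemma is_derive_state (f1 f2 f3 f4 f5 : R -> R) (t : R) a b c d e :
  is_derive t 1 f1 a -> is_derive t 1 f2 b -> is_derive t 1 f3 c ->
  is_derive t 1 f4 d -> is_derive t 1 f5 e ->
  is_derive t 1 (fun s => state (f1 s) (f2 s) (f3 s) (f4 s) (f5 s)) (state a b c d e).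
Proof.
move=> h1 h2 h3 h4 h5.
pose f s := state (f1 s) (f2 s) (f3 s) (f4 s) (f5 s).
have fE i j : is_derive t 1 (fun s => f s i j) (state a b c d e i j).
  case: j => -[|[|[|[|[|//]]]]] j; rewrite mxE /=;
    by under [X in is_derive _ _ X]eq_fun do rewrite mxE /=.
have df : derivable f t 1 by apply/derivable_mxP => i j; case: (fE i j).
apply: DeriveDef => //; rewrite derive_mx//.
by apply/matrixP => i j; rewrite mxE; case: (fE i j).
Qed.

End State.

(** * Differential of the vector field *)

Section FiveModeField.
Variables (R : realType) (lk lm ln lmt lkt G Gt : R).
Implicit Types (p v : 'rV[R]_5).

Local Notation F := (five_mode_field lk lm ln lmt lkt G Gt).

Lemma five_mode_field_sum : F = fun x =>
  ((lm - ln) * G * a_m x * a_n x) *: state 1 0 0 0 0 +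
  ((ln - lk) * G * a_n x * a_k x) *: state 0 1 0 0 0 +
  ((lk - lm) * G * a_k x * a_m x + (lkt - lmt) * Gt * a_kt x * a_mt x)
    *: state 0 0 1 0 0 +
  ((ln - lkt) * Gt * a_n x * a_kt x) *: state 0 0 0 1 0 +
  ((lmt - ln) * Gt * a_mt x * a_n x) *: state 0 0 0 0 1.
Proof. by apply/funext => x; rewrite -state_sum. Qed.

Lemma differentiable_five_mode_field p : differentiable F p.
Proof.
have dc (f : 'rV[R]_5 -> R) (v : 'rV[R]_5) :
    differentiable f p -> differentiable (fun x => f x *: v) p.
  exact: differentiableZl.
have dm (c : R) (i j : 'I_5) :
    differentiable (fun x : 'rV[R]_5 => c * x ord0 i * x ord0 j) p.
  apply: differentiableM; last exact: differentiable_coord.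
  by apply: differentiableM; last exact: differentiable_coord.
rewrite five_mode_field_sum.
by do 4 (apply: differentiableD;
  last by apply: dc; try apply: differentiableD; exact: dm); apply: dc; exact: dm.
Qed.

(** The field is homogeneous quadratic, so the difference quotient at p along v is exactly L + h
    F(v), with L the right-hand side. *)
Lemma jacobian_five_mode_field p v :
  v *m jacobian F p = state
    ((lm - ln) * G * (a_m v * a_n p + a_m p * a_n v))
    ((ln - lk) * G * (a_n v * a_k p + a_n p * a_k v))
    ((lk - lm) * G * (a_k v * a_m p + a_k p * a_m v) +
     (lkt - lmt) * Gt * (a_kt v * a_mt p + a_kt p * a_mt v))
    ((ln - lkt) * Gt * (a_n v * a_kt p + a_n p * a_kt v))
    ((lmt - ln) * Gt * (a_mt v * a_n p + a_mt p * a_n v)).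
Proof.
rewrite -deriveEjacobian; last exact: differentiable_five_mode_field.
set L := state _ _ _ _ _.
apply: cvg_lim => //.
have E : {near 0^', (fun h : R => L + h *: F v) =1
    (fun h => h^-1 *: ((F \o shift p) (h *: v) - F p))}.
  near=> h.
  have h0 : h != 0 by near: h; exact: nbhs_dnbhs_neq.
  have -> : (F \o shift p) (h *: v) - F p = h *: (L + h *: F v).
    have -> : (F \o shift p) (h *: v) = F (h *: v + p) by [].
    rewrite /L /five_mode_field !coordsD !coordsZ stateN !stateZ !stateD stateZ.
    by congr (state _ _ _ _ _); ring.
  by rewrite scalerA mulVf// scale1r.
have : L + h *: F v @[h --> 0^'] --> L + (0 : R) *: F v.
  by apply: cvgD; [exact: cvg_cst|apply: cvgZr_tmp; exact: nbhs_dnbhs].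
by rewrite scale0r addr0; apply: cvg_trans; exact: near_eq_cvg E.
Unshelve. all: by end_near. Qed.

End FiveModeField.

(** * Hyperbolicity is equivalent to positive [growth] *)

Section Hyperbolicity.
Variables (R : realType) (lk lm ln lmt lkt G Gt k0 c : R).
Hypotheses (hmk : lm < lk) (hkn : lk < ln) (hmn : lmt < ln) (hnk : ln < lkt).
Hypotheses (G0 : G != 0) (k00 : k0 != 0) (c0 : c != 0).

Local Notation F := (five_mode_field lk lm ln lmt lkt G Gt).
Local Notation al := (alpha lk lm ln).
Local Notation alt := (alphat ln lmt lkt).
Local Notation p := (state k0 0 0 0 c).
Local Notation J := (jacobian F p).

(* The square of the nonzero eigenvalues of the linearization J at p. *)
Definition growth :=
  (lk - lm) * (ln - lk) * G ^+ 2 * k0 ^+ 2 -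
  (lkt - lmt) * (lkt - ln) * Gt ^+ 2 * c ^+ 2.

Lemma jacobian_critical v : v *m J = state
  0 ((ln - lk) * G * (a_n v * k0))
  ((lk - lm) * G * (k0 * a_m v) + (lkt - lmt) * Gt * (c * a_mt v))
  ((ln - lkt) * Gt * (a_n v * c)) 0.
Proof.
rewrite jacobian_five_mode_field !stateEs.
by congr (state _ _ _ _ _); ring.
Qed.

Lemma jacobian_cube : J *m J *m J = growth *: J.
Proof.
apply/row_matrixP => i; rewrite !rowE -scalemxAr !mulmxA.
set v := delta_mx 0 i.
rewrite (jacobian_critical (v *m J *m J)) (jacobian_critical (v *m J)).
rewrite (jacobian_critical v) !stateEs stateZ /growth.
by congr (state _ _ _ _ _); ring.
Qed.

Lemma critical_point : F p = 0.
Proof.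
rewrite /five_mode_field !stateEs.
have -> : (0 : 'rV[R]_5) = state 0 0 0 0 0.
  by apply: state_inj; rewrite stateEs /a_k /a_m /a_n /a_mt /a_kt mxE.
by congr (state _ _ _ _ _); ring.
Qed.

(** The first and third conserved quantities have nonzero differentials at p, along a_k and a_kt,
    which kills those components in the limit. The second is a quadratic form vanishing at p, so its
    equation is scale invariant and passes to the limit as it is. *)
Lemma tangent_cone_level v : tangent_cone (level_set al alt p) p v ->
  [/\ a_k v = 0, a_kt v = 0 &
      a_n v ^+ 2 + al * a_m v ^+ 2 + (1 - alt) * a_mt v ^+ 2 = 0].
Proof.
move=> [h [u [h0 hcvg ucvg hS]]].
have [uk um un umt ukt] := cvg_coords ucvg.
have hn0 i : h i != 0 by rewrite gt_eqF.
have sq (f : nat -> R) (l : R) : f @ \oo --> l -> f i ^+ 2 @[i --> \oo] --> l ^+ 2.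
  by move=> fl; rewrite expr2; under eq_fun do rewrite expr2; exact: cvgM.
have first_order (f g : nat -> R) (l m x y : R) : x != 0 -> f @ \oo --> l ->
    g @ \oo --> m ->
    (forall i, (x + h i * f i) ^+ 2 + y * (h i * g i) ^+ 2 = x ^+ 2) -> l = 0.
  move=> x0 fl gm E.
  have f0 : f i @[i --> \oo] --> 0 * ((l ^+ 2 + y * m ^+ 2) * (- (2 * x)^-1)).
    have -> : f = fun i => h i * ((f i ^+ 2 + y * g i ^+ 2) * (- (2 * x)^-1)).
      apply/funext => i; apply: (mulfI (hn0 i)).
      have x20 : 2 * x != 0 by rewrite mulf_neq0// pnatr_eq0.
      apply: (mulfI x20); move: (E i) => /eqP; rewrite -subr_eq0 => /eqP Ei.
      apply/eqP; rewrite -subr_eq0 -Ei; apply/eqP; field.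
      by rewrite x0.
    apply: cvgM => //; apply: cvgM; last exact: cvg_cst.
    apply: cvgD; first exact: sq.
    by apply: cvgM; [exact: cvg_cst|exact: sq].
  by rewrite mul0r in f0; exact: (cvg_unique _ fl f0).
split.
- apply: (first_order _ _ _ _ k0 (1 - al) k00 uk um) => i.
  have [+ _ _] := hS i.
  by rewrite /conserved1 !coordsD !coordsZ !stateEs add0r expr0n mulr0 addr0.
- apply: (first_order _ _ _ _ c alt c0 ukt umt) => i.
  have [_ _ +] := hS i.
  by rewrite /conserved3 !coordsD !coordsZ !stateEs add0r expr0n mulr0 addr0.
have q0 i : a_n (u i) ^+ 2 + al * a_m (u i) ^+ 2 + (1 - alt) * a_mt (u i) ^+ 2 = 0.
  have [_ + _] := hS i.
  rewrite /conserved2 !coordsD !coordsZ !stateEs !add0r expr0n/= !mulr0 !addr0 => E.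
  have h20 : h i ^+ 2 != 0 by rewrite expf_neq0.
  by apply: (mulfI h20); rewrite mulr0; apply: etrans E; ring.
have q1 : a_n (u i) ^+ 2 + al * a_m (u i) ^+ 2 + (1 - alt) * a_mt (u i) ^+ 2
    @[i --> \oo] --> (0 : R).
  by under eq_fun do rewrite q0; exact: cvg_cst.
have q2 : a_n (u i) ^+ 2 + al * a_m (u i) ^+ 2 + (1 - alt) * a_mt (u i) ^+ 2
    @[i --> \oo] --> a_n v ^+ 2 + al * a_m v ^+ 2 + (1 - alt) * a_mt v ^+ 2.
  apply: cvgD; last by apply: cvgM; [exact: cvg_cst|exact: sq].
  by apply: cvgD; [exact: sq|apply: cvgM; [exact: cvg_cst|exact: sq]].
exact: (cvg_unique _ q2 q1).
Qed.

Lemma alphaN : - al = (lk - lm) / (ln - lk).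
Proof. by rewrite /alpha -mulNr opprB. Qed.

Lemma alphatB : 1 - alt = (lkt - lmt) / (lkt - ln).
Proof. by rewrite /alphat; field; rewrite subr_eq0 gt_eqF. Qed.

Lemma center_subspace_ker v : 0 < growth -> center_subspace F p v -> v *m J = 0.
Proof.
move=> D0 [s vs].
pose Jc := map_mx (real_complex R) J.
have Jc3 : Jc *m Jc *m Jc = real_complex R growth *: Jc.
  by rewrite -!map_mxM jacobian_cube map_mxZ.
have /sub_kermxP : (map_mx (real_complex R) v <= kermx Jc)%MS.
  apply: submx_trans vs _.
  apply: (big_ind (fun A : 'M[complex R]_5 => (A <= kermx Jc)%MS)).
  - exact: sub0mx.
  - by move=> A B hA hB; rewrite addsmx_sub hA.
  - move=> w _; apply: geigenspace_sub_ker Jc3 _.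
    (* The square of iw is - w^2 <= 0 < [growth], so every summand, w = 0 included, lies in the
       kernel. *)
    rewrite expr2 eq_complex /= mul0r sub0r negb_and; apply/orP; left.
    by rewrite lt_eqF// (le_lt_trans _ D0)// oppr_le0 -expr2 sqr_ge0.
by rewrite -map_mxM => /eqP; rewrite map_mx_eq0 => /eqP.
Qed.

Lemma hyperbolic_growth_gt0 : 0 < growth -> hyperbolic_on (level_set al alt p) F p.
Proof.
move=> D0; split; [exact: critical_point|by []|].
move=> v /tangent_cone_level[vk vkt q] /(center_subspace_ker D0).
rewrite jacobian_critical => vJ.
have n0 : a_n v = 0.
  have := congr1 (@a_m R) vJ; rewrite a_mE [RHS]mxE => /eqP.
  by rewrite !mulf_eq0 subr_eq0 (gt_eqF hkn) (negbTE G0) (negbTE k00) !orbF => /eqP.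
have := congr1 (@a_n R) vJ; rewrite a_nE [RHS]mxE => E.
have lknP : 0 < ln - lk by rewrite subr_gt0.
have lktP : 0 < lkt - ln by rewrite subr_gt0.
have q' : (lkt - lmt) * (ln - lk) * a_mt v ^+ 2 = (lk - lm) * (lkt - ln) * a_m v ^+ 2.
  move: q; rewrite n0 expr0n add0r -[al]opprK alphaN alphatB => q.
  apply/eqP; rewrite -subr_eq0; apply/eqP.
  transitivity ((ln - lk) * (lkt - ln) * (- ((lk - lm) / (ln - lk)) * a_m v ^+ 2 +
    (lkt - lmt) / (lkt - ln) * a_mt v ^+ 2)); last by rewrite q mulr0.
  by field; rewrite !gt_eqF.
have lkP : 0 < lk - lm by rewrite subr_gt0.
have lktmP : 0 < lkt - lmt by rewrite subr_gt0 (lt_trans hmn).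
have m0 : a_m v = 0.
  (* The kernel equation [E] says X + Y = 0 with X a multiple of a_m and Y one of a_mt. Eliminating
     a_mt^2 between X^2 - Y^2 = 0 and the cone relation [q'] leaves [growth] as the coefficient of
     a_m^2. *)
  have : (lk - lm) * (lkt - lmt) * growth * a_m v ^+ 2 = 0.
    transitivity ((lkt - lmt) * (ln - lk) *
      ((lk - lm) * G * (k0 * a_m v) + (lkt - lmt) * Gt * (c * a_mt v)) *
      ((lk - lm) * G * (k0 * a_m v) - (lkt - lmt) * Gt * (c * a_mt v)) +
      ((lkt - lmt) * Gt * c) ^+ 2 * ((lkt - lmt) * (ln - lk) * a_mt v ^+ 2 -
         (lk - lm) * (lkt - ln) * a_m v ^+ 2)).
      by rewrite /growth; ring.
    by rewrite E q' subrr !(mulr0, mul0r) addr0.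
  have K0 : (lk - lm) * (lkt - lmt) * growth != 0 by rewrite gt_eqF ?mulr_gt0.
  by move/eqP; rewrite mulf_eq0 (negbTE K0) sqrf_eq0 => /eqP.
have mt0 : a_mt v = 0.
  move/eqP: q'; rewrite m0 expr0n mulr0 mulf_eq0 gt_eqF ?mulr_gt0//=.
  by rewrite sqrf_eq0 => /eqP.
by apply: state_inj; rewrite ?vk ?vkt ?n0 ?m0 ?mt0 /a_k /a_m /a_n /a_mt /a_kt mxE.
Qed.

Lemma center_subspace_full v : growth <= 0 -> center_subspace F p v.
Proof.
move=> D0; pose Jc := map_mx (real_complex R) J.
have Jc3 : Jc *m Jc *m Jc = real_complex R growth *: Jc.
  by rewrite -!map_mxM jacobian_cube map_mxZ.
move: D0; rewrite le_eqVlt => /orP[/eqP D0|D0].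
  (* Here J^3 = 0: J is nilpotent and the generalized eigenspace of 0 is everything. *)
  exists [:: 0]; rewrite big_seq1 -/Jc geigenspaceE.
  apply/sub_kermxP.
  have -> : Jc - (Complex (0 : R) 0)%:M = Jc.
    by rewrite (_ : Complex (0 : R) 0 = 0)// raddf0 subr0.
  have Jc3' : Jc ^+ 3 = 0.
    transitivity (Jc *m Jc *m Jc); first by rewrite exprS expr2 mulrA.
    by rewrite Jc3 D0 rmorph0 scale0r.
  by rewrite (exprD _ 3 2) Jc3' mul0r mulmx0.
pose w := Num.sqrt (- growth).
have w0 : 0 < w by rewrite sqrtr_gt0 oppr_gt0.
exists [:: 0; w; - w]; rewrite 2!big_cons big_seq1.
have -> : Complex 0 (- w) = - Complex 0 w by rewrite -[RHS]/(Complex (- 0) (- w)) oppr0.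
apply: (geigenspace_sum_full _ Jc3).
  by rewrite eq_complex /= eqxx gt_eqF.
rewrite expr2; apply/eqP; rewrite eq_complex /= !mul0r sub0r mulr0 addr0 eqxx andbT.
by rewrite -expr2 sqr_sqrtr ?opprK// oppr_ge0 ltW.
Qed.

(** Without such a vector, [hyperbolic_on] could hold vacuously when [growth] <= 0. The curve used
    keeps a_mt = 0 and a_kt = c, and takes a_n = r a_m with r^2 = - al so that the second conserved
    quantity stays 0. *)
Lemma tangent_cone_nonzero : exists2 v, v != 0 & tangent_cone (level_set al alt p) p v.
Proof.
have al0 : 0 <= - al by rewrite alphaN divr_ge0 ?subr_ge0 ?ltW.
pose b := 1 - al.
have b0 : 0 < b by rewrite ltr_pwDl.
pose r := Num.sqrt (- al).
(* The rational parametrization of the ellipse a_k^2 + b a_m^2 = k0^2. *)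
pose w (s : R) := (2 * k0 / (1 + b * s ^+ 2)) *: state (- b * s) 1 r 0 0.
exists (w 0).
  apply/eqP => /(congr1 (@a_m R)); rewrite /w coordsZ stateEs [RHS]mxE mulr1.
  rewrite expr0n mulr0 addr0 divr1 => /eqP.
  by rewrite mulf_eq0 pnatr_eq0 (negbTE k00).
exists harmonic, (fun i => w (harmonic i)); split.
- by move=> i; exact: harmonic_gt0.
- exact: cvg_harmonic.
- apply: (cvg_comp _ _ cvg_harmonic).
  pose g (s : R) := 2 * k0 / (1 + b * s ^+ 2).
  have cg : g s @[s --> (0 : R)] --> g 0.
    apply: cvgM; first exact: cvg_cst.
    apply: cvgV; first by rewrite expr0n mulr0 addr0 oner_neq0.
    apply: cvgD; first exact: cvg_cst.
    by apply: cvgM; [exact: cvg_cst|exact: exprn_continuous].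
  have cst_ (r' : R) : (fun=> r') @ (0 : R) --> r' by exact: cvg_cst.
  have id_ : - b * s @[s --> (0 : R)] --> - b * 0.
    by apply: cvgM; [exact: cvg_cst|exact: cvg_id].
  have -> : w = fun s =>
      state (g s * (- b * s)) (g s * 1) (g s * r) (g s * 0) (g s * 0).
    by apply/funext => s; rewrite -stateZ.
  apply: cvg_state; [exact: (cvgM cg id_)|exact: (cvgM cg (cst_ 1))|
    exact: (cvgM cg (cst_ r))|exact: (cvgM cg (cst_ 0))|exact: (cvgM cg (cst_ 0))].
- move=> i; set s := harmonic i.
  have d0 : 1 + b * s ^+ 2 != 0 by rewrite gt_eqF// ltr_pwDl// mulr_ge0 ?sqr_ge0 ?ltW.
  have r2 : r ^+ 2 = - al by rewrite sqr_sqrtr.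
  split.
  + rewrite /conserved1 /w !coordsD !coordsZ !stateEs; rewrite -/b; field.
    by [].
  + rewrite /conserved2 /w !coordsD !coordsZ !stateEs.
    rewrite !mulr1 !mulr0 !add0r expr0n /= !mulr0 !addr0 !exprMn r2; ring.
  + by rewrite /conserved3 /w !coordsD !coordsZ !stateEs !mulr0 !addr0.
Qed.

Lemma hyperbolic_growthE :
  hyperbolic_on (level_set al alt p) F p <-> 0 < growth.
Proof.
split=> [[_ _ hyp]|]; last exact: hyperbolic_growth_gt0.
rewrite ltNge; apply/negP => D0.
have [v v0 vt] := tangent_cone_nonzero.
by move/eqP: v0; apply; apply: hyp => //; exact: center_subspace_full.
Qed.

End Hyperbolicity.

(** * Lifting the scalar motion to a homoclinic orbit *)

Section HomoclinicCycle.
Variable R : realType.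

(** The two equalities are what (cos(w q), A sin(w q)) must satisfy to solve a pair of mode
    equations driven by q' = a_n; likewise for cosh and sinh. [A] carries the sign of g so that w =
    |g| sqrt(x y) is positive. *)
Lemma rotation_constants (g x y : R) : g != 0 -> 0 < x -> 0 < y ->
  exists A w : R, [/\ 0 < w, x * g * A = w & A * w = y * g].
Proof.
move=> g0 x0 y0; pose r := Num.sqrt (y / x).
have r2 : r ^+ 2 = y / x by rewrite sqr_sqrtr// ltW// divr_gt0.
exists (Num.sg g * r), (`|g| * x * r); split.
- by rewrite !mulr_gt0 ?normr_gt0// sqrtr_gt0 divr_gt0.
- by rewrite -[`|g|]mulr1 normrEsg; ring.
- have -> : Num.sg g * r * (`|g| * x * r) = (Num.sg g * `|g|) * x * r ^+ 2 by ring.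
  by rewrite -numEsg r2; field; rewrite gt_eqF.
Qed.

Lemma sinhR_inj : injective (@sinhR R).
Proof.
have lt (x y : R) : x < y -> sinhR x < sinhR y.
  move=> xy; apply: (is_derive_gt0_lt xy (fun z _ => is_derive_sinhR z)) => z _.
  exact: coshR_gt0.
by move=> x y E; case: (ltgtP x y) => // /lt; rewrite E ltxx.
Qed.

Variables (lk lm ln lmt lkt G Gt k0 c : R).
Hypotheses (hmk : lm < lk) (hkn : lk < ln) (hmn : lmt < ln) (hnk : ln < lkt).
Hypotheses (G0 : G != 0) (Gt0 : Gt != 0) (k00 : k0 != 0) (c0 : c != 0).

Local Notation F := (five_mode_field lk lm ln lmt lkt G Gt).
Local Notation al := (alpha lk lm ln).
Local Notation alt := (alphat ln lmt lkt).
Local Notation p := (state k0 0 0 0 c).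

Lemma homoclinic_cycle_of_growth_gt0 :
  0 < growth lk lm ln lmt lkt G Gt k0 c ->
  exists2 C : set 'rV[R]_5, homoclinic_cycle1 F p C & C `<=` cone al alt.
Proof.
move=> D0.
have lnmP : 0 < ln - lm by rewrite subr_gt0 (lt_trans hmk).
have lnkP : 0 < ln - lk by rewrite subr_gt0.
have lkmP : 0 < lk - lm by rewrite subr_gt0.
have lnmtP : 0 < ln - lmt by rewrite subr_gt0.
have lktnP : 0 < lkt - ln by rewrite subr_gt0.
have lktmtP : 0 < lkt - lmt by rewrite subr_gt0 (lt_trans hmn).
have [A [w [w0 AE1 AE2]]] := rotation_constants G0 lnmP lnkP.
have [B [m [m0 BE1 BE2]]] := rotation_constants Gt0 lnmtP lktnP.
have A0 : A != 0 by apply: contraTneq w0 => A0; rewrite -AE1 A0 mulr0 ltxx.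
have B0 : B != 0 by apply: contraTneq m0 => B0; rewrite -BE1 B0 mulr0 ltxx.
have alE : - al * (ln - lk) = lk - lm by rewrite alphaN divfK// gt_eqF.
have altE : (1 - alt) * (lkt - ln) = lkt - lmt by rewrite alphatB// divfK// gt_eqF.
have al0 : 0 < - al by rewrite alphaN divr_gt0.
have alt0 : 0 < 1 - alt by rewrite alphatB// divr_gt0.
(* [a] and [b] are chosen so that on the cone, with a_m = k0 A sin(w q) and a_mt = - c B sinh(m q),
   a_n^2 becomes V(q). *)
pose a := Num.sqrt (- al) * `|k0| * `|A|.
pose b := Num.sqrt (1 - alt) * `|c| * `|B|.
have a0 : 0 < a by rewrite !mulr_gt0 ?normr_gt0// sqrtr_gt0.
have b0 : 0 < b by rewrite !mulr_gt0 ?normr_gt0// sqrtr_gt0.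
have a2 : a ^+ 2 = - al * k0 ^+ 2 * A ^+ 2.
  by rewrite !exprMn !real_normK ?num_real// sqr_sqrtr// ltW.
have b2 : b ^+ 2 = (1 - alt) * c ^+ 2 * B ^+ 2.
  by rewrite !exprMn !real_normK ?num_real// sqr_sqrtr// ltW.
clearbody a b.
have lt_bm_aw : b * m < a * w.
  have bm0 : 0 <= b * m by rewrite mulr_ge0// ltW.
  have aw0 : 0 <= a * w by rewrite mulr_ge0// ltW.
  (* The difference (a w)^2 - (b m)^2 is [growth]. *)
  rewrite -ltr_sqr ?nnegrE// -subr_gt0; move: D0; congr (0 < _).
  rewrite !exprMn a2 b2 /growth -alE -altE.
  transitivity (- al * k0 ^+ 2 * (A * w) ^+ 2 - (1 - alt) * c ^+ 2 * (B * m) ^+ 2);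
    last by ring.
  by rewrite AE2 BE2; ring.
have [x0 [x00 Vx0 dVx0 Vpos [dV VC]]] := sin_sinh_well a0 b0 w0 m0 lt_bm_aw.
have [q [v [dq dv vsq q0 [qv_inj qp qn]]]] :=
  potential_homoclinic x00 (mulr_gt0 a0 w0) dV Vx0 dVx0 Vpos VC.
pose o t := state (k0 * cos (w * q t)) (k0 * A * sin (w * q t)) (v t)
  (- (c * B) * sinhR (m * q t)) (c * coshR (m * q t)).
have chain (f : R -> R) (df s : R) (r t : R) : is_derive (s * q t) 1 f df ->
    is_derive t 1 (fun u => r * f (s * q u)) (r * (df * s * v t)).
  move=> fdf.
  have d1 := @is_derive1_comp _ (fun y => f (s * y)) q t _ _
    (is_derive_compZ fdf) (dq t).
  exact: is_deriveZ d1.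
have chains t := And4 (chain _ _ w k0 t (is_derive_cos (w * q t)))
  (chain _ _ w (k0 * A) t (is_derive_sin (w * q t)))
  (chain _ _ m (- (c * B)) t (is_derive_sinhR (m * q t)))
  (chain _ _ m c t (is_derive_coshR (m * q t))).
have osol : solution F o.
  move=> t; have [dk dm dmt dkt] := chains t.
  apply: is_derive_eq (is_derive_state dk dm (dv t) dmt dkt) _.
  rewrite /five_mode_field /o !stateEs; congr (state _ _ _ _ _).
  - by rewrite -AE1; ring.
  - transitivity (k0 * (A * w) * cos (w * q t) * v t); first by ring.
    by rewrite AE2; ring.
  - rewrite [2 * _]mulrC mulfK ?pnatr_eq0// a2 b2 -alE -altE.
    transitivity (- al * k0 ^+ 2 * A * (A * w) * sin (w * q t) * cos (w * q t) -
      (1 - alt) * c ^+ 2 * B * (B * m) * sinhR (m * q t) * coshR (m * q t)).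
      by ring.
    by rewrite AE2 BE2; ring.
  - transitivity (- c * (B * m) * coshR (m * q t) * v t); first by ring.
    by rewrite BE2; ring.
  - by rewrite -BE1; ring.
have on t : a_n ('D_1 o t) = 'D_1 v t.
  have [dk dm dmt dkt] := chains t.
  by have [_ ->] := is_derive_state dk dm (dv t) dmt dkt; rewrite stateEs derive_val.
have oF t : 'D_1 o t = F (o t) by case: (osol t).
have cB0 : - (c * B) != 0 by rewrite oppr_eq0 mulf_neq0.
have sinh0 t : sinhR (m * q t) != 0.
  by rewrite gt_eqF// sinhR_gt0// mulr_gt0//; case/andP: (q0 t).
have ocone t : cone al alt (o t).
  rewrite /cone /= /o !stateEs vsq.
  have -> : - al * (k0 * A * sin (w * q t)) ^+ 2 = a ^+ 2 * sin (w * q t) ^+ 2.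
    by rewrite a2; ring.
  by rewrite b2; ring.
have olim (T : set_system R) : Filter T -> q @ T --> (0 : R) -> o @ T --> p.
  move=> FT q_0.
  have comp (f : R -> R) : {for 0, continuous f} -> f (q t) @[t --> T] --> f 0.
    by move=> cf; exact: cvg_comp q_0 cf.
  have cV := is_derive_continuous (dV 0).
  (* The limit of v comes from v^2 = V(q) and V(0) = 0. *)
  have v_0 : v t @[t --> T] --> (0 : R).
    apply/norm_cvg0P.
    have -> : (fun t => `|v t|) = fun t => Num.sqrt (v t ^+ 2).
      by apply/funext => t; rewrite sqrtr_sqr.
    under eq_fun do rewrite vsq.
    have := comp _ (continuous_comp cV (@sqrt_continuous R _)).
    by rewrite /= !mulr0 sin0 sinhR0 expr0n/= !mulr0 subr0 sqrtr0.
  have scaled (f : R -> R) (s r : R) : continuous f ->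
      r * f (s * q t) @[t --> T] --> r * f 0.
    move=> cf; apply: cvgM; first exact: cvg_cst.
    have sq : s * q t @[t --> T] --> s * 0 by apply: cvgM => //; exact: cvg_cst.
    by rewrite mulr0 in sq; exact: (cvg_comp _ _ sq (cf 0)).
  have cs (f df : R -> R) : (forall x : R, is_derive x 1 f (df x)) -> continuous f.
    by move=> fdf x; exact: is_derive_continuous (fdf x).
  have -> : p = state (k0 * cos 0) (k0 * A * sin 0) 0
      (- (c * B) * sinhR 0) (c * coshR 0).
    by rewrite cos0 sin0 sinhR0 coshR0 !mulr0 !mulr1.
  apply: cvg_state.
  - exact: scaled (@continuous_cos R).
  - exact: scaled (@continuous_sin R).
  - exact: v_0.
  - exact: scaled (cs _ _ (@is_derive_sinhR R)).
  - exact: scaled (cs _ _ (@is_derive_coshR R)).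
exists ([set p] `|` range o); last first.
  move=> x [->|[t _ <-]]; last exact: ocone.
  by rewrite /cone /= !stateEs expr0n/= !mulr0 addr0.
exists o; split => //.
- split => //.
  + move=> t /(congr1 (@a_mt R)); rewrite !stateEs => /eqP.
    by rewrite (negbTE (mulf_neq0 cB0 (sinh0 t))).
  + exact: olim.
  + exact: olim.
- move=> s t st; apply: qv_inj; last by have := congr1 (@a_n R) st; rewrite !stateEs.
  have := congr1 (@a_mt R) st; rewrite !stateEs.
  by move=> /(mulfI cB0)/sinhR_inj/(mulfI (lt0r_neq0 m0)).
(* A zero velocity forces v = 0 by the a_mt component, hence q = x0 because V > 0 before x0. But
   there the a_n component is V'(x0) / 2 < 0. *)
- move=> t; rewrite oF => Fo.
  have v0 : v t = 0.
    have := congr1 (@a_mt R) Fo; rewrite !stateEs [RHS]mxE => /eqP.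
    have h1 : (ln - lkt) * Gt != 0 by rewrite mulf_neq0// subr_eq0 lt_eqF.
    have h2 : c * coshR (m * q t) != 0 by rewrite mulf_neq0// gt_eqF// coshR_gt0.
    by rewrite -mulrA mulrCA mulf_eq0 (negbTE (mulf_neq0 h1 h2)) orbF => /eqP.
  have qx0 : q t = x0.
    apply/eqP; case/andP: (q0 t) => qt0; rewrite le_eqVlt => /orP[//|qtx0].
    have := Vpos (q t); rewrite qt0 qtx0 => /(_ isT).
    by rewrite -vsq v0 expr0n ltxx.
  have := on t; rewrite oF Fo [LHS]mxE derive_val qx0 => /esym/eqP.
  by rewrite mulf_eq0 invr_eq0 pnatr_eq0 orbF lt_eqF.
Qed.

End HomoclinicCycle.

Theorem corollary4p14 (R : realType) (lk lm ln lmt lkt G Gt : R)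
  (hG : G != 0) (hGt : Gt != 0)
  (hmk : lm < lk) (hkn : lk < ln) (hmn : lmt < ln) (hnk : ln < lkt) :
  let al := alpha lk lm ln in
  let alt := alphat ln lmt lkt in
  let F := five_mode_field lk lm ln lmt lkt G Gt in
  let p (ak0 akt0 : R) := state ak0 0 0 0 akt0 in
  let hyperbolic (x : 'rV[R]_5) := hyperbolic_on (level_set al alt x) F x in
  [/\ al < 0,
      alt < 0,
      exists2 delta : R, 0 < delta &
        forall ak0 akt0 : R, ak0 != 0 -> akt0 != 0 ->
          `|akt0| <= delta * `|ak0| -> hyperbolic (p ak0 akt0) &
      forall ak0 akt0 : R, ak0 != 0 -> akt0 != 0 ->
        hyperbolic (p ak0 akt0) ->
        exists2 C : set 'rV[R]_5,
          homoclinic_cycle1 F (p ak0 akt0) C & C `<=` cone al alt].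
Proof.
move=> al alt F p hyperbolic.
have lnkP : 0 < ln - lk by rewrite subr_gt0.
have lkmP : 0 < lk - lm by rewrite subr_gt0.
have lnmtP : 0 < ln - lmt by rewrite subr_gt0.
have lktnP : 0 < lkt - ln by rewrite subr_gt0.
have lktmtP : 0 < lkt - lmt by rewrite subr_gt0 (lt_trans hmn).
split.
- by rewrite -oppr_gt0 /al alphaN divr_gt0.
- by rewrite /alt /alphat pmulr_llt0 ?invr_gt0// subr_lt0.
- pose P := (lk - lm) * (ln - lk) * G ^+ 2.
  pose Q := (lkt - lmt) * (lkt - ln) * Gt ^+ 2.
  have sqr_gt0 (x : R) : x != 0 -> 0 < x ^+ 2 by move=> x0; rewrite exprn_even_gt0.
  have P0 : 0 < P := mulr_gt0 (mulr_gt0 lkmP lnkP) (sqr_gt0 _ hG).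
  have Q0 : 0 < Q := mulr_gt0 (mulr_gt0 lktmtP lktnP) (sqr_gt0 _ hGt).
  have PQ0 : 0 < P + Q by rewrite addr_gt0.
  (* Positive [growth] amounts to Q a_kt(0)^2 < P a_k(0)^2. This delta satisfies Q delta^2 < P and
     avoids the square root of the sharp ratio. *)
  exists (P / (P + Q)); first by rewrite divr_gt0.
  move=> ak0 akt0 ak00 akt00 small.
  apply: hyperbolic_growth_gt0 => //; rewrite /growth -/P -/Q subr_gt0.
  have small2 : akt0 ^+ 2 <= (P / (P + Q)) ^+ 2 * ak0 ^+ 2.
    rewrite -(real_normK (num_real akt0)) -(real_normK (num_real ak0)) -exprMn.
    by rewrite ler_sqr// nnegrE mulr_ge0// divr_ge0 ?ltW.
  apply: le_lt_trans (ler_wpM2l (ltW Q0) small2) _.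
  rewrite mulrA (ltr_pM2r (sqr_gt0 _ ak00)) -subr_gt0.
  have -> : P - Q * (P / (P + Q)) ^+ 2 =
      P * (P ^+ 2 + P * Q + Q ^+ 2) / (P + Q) ^+ 2.
    by field; rewrite gt_eqF.
  apply: divr_gt0 (mulr_gt0 P0 _) (exprn_gt0 2 PQ0).
  exact: addr_gt0 (addr_gt0 (exprn_gt0 2 P0) (mulr_gt0 P0 Q0)) (exprn_gt0 2 Q0).
- move=> ak0 akt0 ak00 akt00 /hyperbolic_growthE hyp.
  by apply: homoclinic_cycle_of_growth_gt0 => //; exact: hyp.
Qed.
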